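(* Let $G$ be a finite simple graph with vertex set $V$. Then $$\mathcal M(G)\le \lambda_{\max}(G)\le \Big(\tfrac14\log|V|+1\Big)\,\mathcal M(G).$$
   Context: $\lambda_{\max}(G)$ is the largest eigenvalue of the adjacency matrix $A$ of $G$. For subsets $X,Y\subseteq V$, $e(X,Y)$ denotes the number of ordered pairs $(x,y)\in X\times Y$ with $xy$ an edge of $G$; thus $e(X,Y)=\xi^tA\eta$, where $\xi,\eta$ are the characteristic vectors of $X,Y$, and an edge with both ends in $X\cap Y$ is counted twice. Define $$\mathcal M(G):=\max_{\emptyset\ne X,Y\subseteq V}\frac{e(X,Y)}{\sqrt{|X||Y|}}.$$ $\log$ denotes the natural logarithm. *)

(* Defs.v *)
(* MathComp / MathComp-Analysis *)
From HB Require Import structures.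
From mathcomp Require Import all_boot all_order all_algebra.
From mathcomp Require Import boolp classical_sets reals exp.

Set Implicit Arguments.
Unset Strict Implicit.
Unset Printing Implicit Defensive.

Import Order.TTheory GRing.Theory Num.Theory.

Local Open Scope ring_scope.

(* A finite simple graph is a symmetric irreflexive adj : rel V on a finType V.
   Matrix rows and columns are indexed by V through its enumeration. *)
Definition adjacency (R : realType) (V : finType) (adj : rel V) : 'M[R]_#|V| :=
  \matrix_(i < #|V|, j < #|V|) (adj (enum_val i) (enum_val j))%:R.

(* For nonempty V and symmetric adj the set of eigenvalues is finite and
   nonempty, so the supremum is its largest element.  For empty V there is no
   eigenvalue and the value is 0. *)
Definition lambda_max (R : realType) (V : finType) (adj : rel V) : R :=
  sup [set a : R | eigenvalue (adjacency R adj) a]%classic.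

Definition edges_between (V : finType) (adj : rel V) (X Y : {set V}) : nat :=
  #|[set p : V * V | [&& p.1 \in X, p.2 \in Y & adj p.1 p.2]]|.

(* The quotients are nonnegative, so the base value 0 of the iterated maximum
   matters only when V is empty, i.e. when there is no admissible pair. *)
Definition cutM (R : realType) (V : finType) (adj : rel V) : R :=
  \big[Num.max/0]_(P : {set V} * {set V} | (P.1 != finset.set0) && (P.2 != finset.set0))
    ((edges_between adj P.1 P.2)%:R / Num.sqrt (#|P.1|%:R * #|P.2|%:R)).

(* Main.v *)
(* Left inequality: the maximum a of the Rayleigh quotient of the adjacency
   matrix A is an eigenvalue, and, A being entrywise nonnegative,
   |<f, A f>| <= a |f|^2 for every f; polarisation at normalised indicator
   functions gives e(X, Y) <= a sqrt (|X| |Y|).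
   Right inequality: it suffices to bound <f, A f> for f = |w|, w an eigenvector.
   Let y_0 >= ... >= y_(n-1) be the values of f and y_n = 0.  Writing f as a
   combination of the indicators of its level sets, of sizes 1, ..., n, gives
   <f, A f> <= M (sum_k (y_k - y_(k+1)) sqrt (k+1))^2
             = M (sum_k y_k (sqrt (k+1) - sqrt k))^2,
   and Cauchy-Schwarz reduces the claim to
   sum_(k < n) (sqrt (k+1) - sqrt k)^2 <= 1 + (ln n) / 4. *)
Require Import Defs.
From mathcomp Require Import all_boot all_order all_algebra.
From mathcomp Require Import ring lra.
From mathcomp Require Import boolp classical_sets reals exp.
From mathcomp Require Import topology normedtype derive realfun.

Import Order.TTheory GRing.Theory Num.Theory.
Import numFieldNormedType.Exports.

Local Open Scope ring_scope.

(** * The logarithmic bound on squared increments of the square root *)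

(** The function ln t + 4 / (t + 1) has derivative (t - 1)^2 / (t (t + 1)^2) >= 0 on [1, u] and
    takes the value 2 at t = 1. *)
Lemma ln_ge_cayley (R : realType) (u : R) : 1 <= u ->
  2 * (u - 1) / (u + 1) <= ln u.
Proof.
move=> u1.
pose f (t : R) : R := ln t + 4 * (t + 1)^-1.
have df (t : R) : 1 <= t -> is_derive t 1 f (t^-1 - 4 / (t + 1) ^+ 2).
  move=> t1; have t0 : 0 < t by lra.
  have H := is_derive1_ln t0.
  have t10 : t + 1 != 0 by lra.
  have H2 : is_derive t 1 (fun t : R => t + 1) 1.
    by apply: is_derive_eq; rewrite addr0.
  apply: is_derive_eq.
  rewrite /GRing.scale/=; field; lra.
have cf : ({within `[1, u], continuous f})%classic.
  apply: derivable_within_continuous => t; rewrite in_itv/= => /andP[t1 _].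
  exact: (@ex_derive _ _ _ _ _ _ _ (df t t1)).
have H : f 1 <= f u.
  apply: (ger0_derive1_le_cc _ _ cf) => //.
  - move=> t; rewrite in_itv/= => /andP[t1 _].
    exact: (@ex_derive _ _ _ _ _ _ _ (df t (ltW t1))).
  - move=> t; rewrite in_itv/= => /andP[t1 _].
    rewrite derive1E (@derive_val _ _ _ _ _ _ _ (df t (ltW t1))).
    have -> : t^-1 - 4 / (t + 1) ^+ 2 = (t - 1) ^+ 2 / (t * (t + 1) ^+ 2).
      field; lra.
    apply: divr_ge0; [exact: sqr_ge0 | apply: mulr_ge0; [lra | exact: sqr_ge0]].
  - by rewrite in_itv/= lexx.
  - by rewrite in_itv/= lexx andbT.
move: H; rewrite /f ln1.
have -> : 2 * (u - 1) / (u + 1) = 2 - 4 * (u + 1)^-1 by field; lra.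
have -> : 4 * (1 + 1 : R)^-1 = 2 by field.
lra.
Qed.

(** The term k = 0 contributes the constant 1. Each later term is at most ln ((k + 1) / k) / 4, by
    the previous lemma at u = sqrt (k + 1) / sqrt k, and these bounds telescope. *)
Lemma sum_sqr_sqrtB_le (R : realType) (n : nat) :
  \sum_(k < n.+1) (Num.sqrt (k.+1%:R : R) - Num.sqrt k%:R) ^+ 2
    <= 4^-1 * ln (n.+1%:R : R) + 1.
Proof.
elim: n => [|n IHn].
  by rewrite big_ord1 sqrtr0 sqrtr1 ln1; lra.
rewrite big_ord_recr /=.
set s := Num.sqrt n.+1%:R; set t := Num.sqrt n.+2%:R.
have s0 : 0 < s by rewrite sqrtr_gt0 ltr0n.
have t0 : 0 < t by rewrite sqrtr_gt0 ltr0n.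
have Es : s ^+ 2 = n.+1%:R by rewrite sqr_sqrtr ?ler0n.
have Et : t ^+ 2 = n.+2%:R by rewrite sqr_sqrtr ?ler0n.
have st : s <= t by rewrite ler_sqrt ?ler_nat ?ltr0n.
have Hu : 1 <= t / s by rewrite ler_pdivlMr// mul1r.
have := ln_ge_cayley R _ Hu.
rewrite ln_div ?posrE// in IHn *.
have lnX (r : R) : 0 < r -> ln (r ^+ 2) = 2 * ln r.
  by move=> r0; rewrite expr2 lnM ?posrE//; ring.
move: IHn; rewrite -Es -Et !lnX//.
have D : t ^+ 2 - s ^+ 2 = 1.
  by rewrite Es Et -[n.+2]addn1 natrD addrAC subrr add0r.
(* As t^2 - s^2 = 1, the Cayley quotient at u = t / s is (t - s)^2, up to the 2. *)
have -> : 2 * (t / s - 1) / (t / s + 1) = 2 * (t - s) ^+ 2.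
  have -> : 2 * (t - s) ^+ 2 = 2 * (t - s) * (t ^+ 2 - s ^+ 2) / (t + s).
    field; lra.
  rewrite D; field; lra.
lra.
Qed.

(** * The Rayleigh quotient of a real symmetric matrix *)

(** The quadratic form attains its maximum on the compact unit sphere at some c, and varying c shows
    that c is an eigenvector for that maximum. *)
Lemma symmetric_rayleigh (R : realType) (n : nat) (B : 'M[R]_n) :
  (0 < n)%N -> B^T = B ->
  exists2 a, eigenvalue B a &
    forall x : 'rV_n, (x *m B *m x^T) 0 0 <= a * (x *m x^T) 0 0.
Proof.
case: n B => // n B _ Bsym.
pose q (x : 'rV[R]_n.+1) : R := (x *m B *m x^T) 0 0.
pose nn (x : 'rV[R]_n.+1) : R := (x *m x^T) 0 0.
have nnE x : nn x = \sum_i x 0 i ^+ 2.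
  by rewrite /nn mxE; apply: eq_bigr => i _; rewrite mxE expr2.
have nn_ge0 x : 0 <= nn x by rewrite nnE sumr_ge0// => i _; exact: sqr_ge0.
have nn_eq0 x : nn x = 0 -> x = 0.
  rewrite nnE => /eqP; rewrite psumr_eq0 => [|i _]; last exact: sqr_ge0.
  move=> /allP H; apply/rowP => i; rewrite mxE; apply/eqP.
  by have := H i (mem_index_enum i); rewrite sqrf_eq0.
have csum (F : 'I_n.+1 -> 'rV[R]_n.+1 -> R) :
    (forall i, continuous (F i)) -> continuous (fun x => \sum_i F i x).
  by move=> cF; apply: continuous_big => [|i _]; [exact: add_continuous|exact: cF].
have ccoord i : continuous (fun x : 'rV[R]_n.+1 => x 0 i).
  exact: coord_continuous.
have cnn : continuous nn.
  rewrite (_ : nn = fun x => \sum_i x 0 i ^+ 2); last by apply/funext => x.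
  by apply: (csum) => i x; apply: (continuousM (ccoord i x) (ccoord i x)).
have cq : continuous q.
  rewrite (_ : q = fun x => \sum_j (\sum_i x 0 i * B i j) * x 0 j).
    apply: (csum) => j x; apply: continuousM; last exact: ccoord.
    move: x; apply: (csum) => i x; apply: continuousM; first exact: ccoord.
    exact: cst_continuous.
  apply/funext => x; rewrite /q mxE; apply: eq_bigr => j _.
  by rewrite !mxE.
pose S : set 'rV[R]_n.+1 := [set x | nn x = 1]%classic.
have S0 : (S !=set0)%classic.
  exists (delta_mx 0 0); rewrite /S/= nnE (bigD1 0)//= big1 ?mxE ?eqxx ?expr1n ?addr0//.
  by move=> i i0; rewrite mxE eqxx (negPf i0) expr0n.
have cS : compact S.
  apply: bounded_closed_compact.
    exists 1; split; first exact: num_real.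
    move=> r r1 x Sx /=; apply: le_trans (ltW r1).
    (* The norm here is the maximum norm, and each squared coordinate is at most [nn x], which is 1
       on [S]. *)
    rewrite [`|x|]mx_normrE; apply/bigmax_leP; split => // i _.
    rewrite -(@ler_pXn2r _ 2) ?nnegrE// expr1n (ord1 i.1) real_normK ?num_real//.
    rewrite -Sx nnE (bigD1 i.2)//= lerDl sumr_ge0// => j _; exact: sqr_ge0.
  rewrite (_ : S = nn @^-1` [set 1])%classic//.
  by have /continuous_closedP := cnn; apply; exact: closed_eq.
have [c cS' cmax] := EVT_max_rV S0 cS (continuous_subspaceT cq).
move: cS'; rewrite inE /S/= => c1.
have qZ t x : q (t *: x) = t ^+ 2 * q x.
  by rewrite /q linearZ/= -scalemxAl -scalemxAl -scalemxAr !mxE; ring.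
have nnZ t x : nn (t *: x) = t ^+ 2 * nn x.
  by rewrite /nn linearZ/= -scalemxAl -scalemxAr !mxE; ring.
have qle x : q x <= q c * nn x.
  have [/eqP x0|x0] := boolP (nn x == 0).
    by rewrite x0 mulr0 (nn_eq0 _ x0) /q !mul0mx mxE.
  have xp : 0 < nn x by rewrite lt_neqAle eq_sym x0 nn_ge0.
  have sp : (Num.sqrt (nn x))^-1 ^+ 2 = (nn x)^-1.
    by rewrite exprVn sqr_sqrtr.
  have := cmax ((Num.sqrt (nn x))^-1 *: x).
  rewrite inE /S/= nnZ sp mulVf// => /(_ erefl).
  by rewrite qZ sp mulrC ler_pdivrMr.
exists (q c) => //.
apply/eigenvalueP; exists c; last first.
  apply/eqP => c0; move: c1; rewrite c0 /nn mul0mx mxE => /eqP.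
  by rewrite eq_sym oner_eq0.
apply/eqP; rewrite -subr_eq0; apply/eqP/nn_eq0.
(* The existential makes the residual [y] opaque, so that the expansions below treat it as an atom;
   the goal becomes [nn y = 0]. *)
have [y yE] : exists y : 'rV[R]_n.+1, y = c *m B - q c *: c.
  by exists (c *m B - q c *: c).
rewrite -yE.
have tr11 (A : 'M[R]_1) : A^T 0 0 = A 0 0 by rewrite mxE.
have add11 (A A' : 'M[R]_1) : (A + A') 0 0 = A 0 0 + A' 0 0 by rewrite mxE.
have scale11 t (A : 'M[R]_1) : (t *: A) 0 0 = t * A 0 0 by rewrite mxE.
have qD t : q (c + t *: y) = q c + 2 * t * (c *m B *m y^T) 0 0 + t ^+ 2 * q y.
  have E : (y *m B *m c^T) 0 0 = (c *m B *m y^T) 0 0.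
    by rewrite -tr11 !trmx_mul trmxK Bsym mulmxA.
  rewrite /q [(c + _)^T]linearD/= [(t *: y)^T]linearZ/=.
  rewrite !mulmxDl !mulmxDr -!scalemxAl -!scalemxAr.
  by rewrite -?scalemxAl !(add11, scale11) E; ring.
have nnD t : nn (c + t *: y) = nn c + 2 * t * (c *m y^T) 0 0 + t ^+ 2 * nn y.
  have E : (y *m c^T) 0 0 = (c *m y^T) 0 0 by rewrite -tr11 trmx_mul trmxK.
  rewrite /nn [(c + _)^T]linearD/= [(t *: y)^T]linearZ/=.
  rewrite !mulmxDl !mulmxDr -!scalemxAl -!scalemxAr.
  by rewrite !(add11, scale11) E; ring.
have Ey : (c *m B *m y^T) 0 0 - q c * (c *m y^T) 0 0 = nn y.
  have opp11 (A : 'M[R]_1) : (- A) 0 0 = - A 0 0 by rewrite mxE.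
  rewrite /nn [X in _ = (X *m _) 0 0]yE mulmxBl -scalemxAl.
  by rewrite add11 opp11 scale11.
pose K := q c * nn y - q y.
have K0 : 0 <= K by rewrite subr_ge0.
(* First-order condition at the maximiser c, in the direction y = c B - q(c) c. *)
have H t : 2 * t * nn y <= t ^+ 2 * K.
  have := qle (c + t *: y); rewrite qD nnD c1 -{2}Ey /K; lra.
have K1 : K + 1 != 0 by rewrite gt_eqF// ltr_wpDl.
(* At this t the inequality reads t^2 * 2 (K + 1) <= t^2 K, absurd unless t = 0. The shift by 1
   keeps the denominator positive when K = 0. *)
have := H (nn y / (K + 1)).
have -> : 2 * (nn y / (K + 1)) * nn y = (nn y / (K + 1)) ^+ 2 * (2 * (K + 1)).
  by field.
move=> H1; apply/eqP; rewrite eq_le nn_ge0 andbT leNgt; apply/negP => y0.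
have : 0 < (nn y / (K + 1)) ^+ 2 by rewrite exprn_gt0// divr_gt0//; lra.
move=> /ler_pM2l /(_ (2 * (K + 1)) K); rewrite H1 => /esym; lra.
Qed.

(** * Cauchy-Schwarz, summation by parts and level sets *)

(** Lagrange's identity: the difference of the two sides is half the sum of the squares (a_i b_j -
    a_j b_i)^2. *)
Lemma sum_mul_sqr_le (R : realType) (n : nat) (a b : 'I_n -> R) :
  (\sum_i a i * b i) ^+ 2 <= (\sum_i a i ^+ 2) * (\sum_i b i ^+ 2).
Proof.
have : 0 <= \sum_i \sum_j (a i * b j - a j * b i) ^+ 2.
  by apply: sumr_ge0 => i _; apply: sumr_ge0 => j _; exact: sqr_ge0.
have sum2 (F G : 'I_n -> R) :
    \sum_i \sum_j F i * G j = (\sum_i F i) * (\sum_j G j).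
  by rewrite mulr_suml; apply: eq_bigr => i _; rewrite mulr_sumr.
have -> : \sum_i \sum_j (a i * b j - a j * b i) ^+ 2 =
    2 * ((\sum_i a i ^+ 2) * (\sum_i b i ^+ 2)) - 2 * (\sum_i a i * b i) ^+ 2.
  have -> (A B : R) : 2 * (A * B) = A * B + B * A by ring.
  rewrite expr2 -!sum2 mulr_sumr -big_split/= -sumrB.
  apply: eq_bigr => i _; rewrite mulr_sumr -big_split/= -sumrB.
  by apply: eq_bigr => j _; ring.
lra.
Qed.

Lemma sum_by_parts (R : realType) (y s : nat -> R) (n : nat) :
  s 0 = 0 ->
  \sum_(k < n) (y k - y k.+1) * s k.+1 =
  \sum_(k < n) y k * (s k.+1 - s k) - y n * s n.
Proof.
move=> s0; elim: n => [|n IHn]; first by rewrite !big_ord0 s0 mulr0 subr0.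
by rewrite !big_ord_recr /= IHn; ring.
Qed.

(** List V by decreasing value of x and let [X k] be the first k + 1 vertices. Ties do no harm: a
    prefix that cuts through equal values gets coefficient 0, so every size from 1 to #|V| can be
    used exactly once. *)
Lemma level_sets (R : realType) (V : finType) (x : V -> R) :
  (forall u, 0 <= x u) ->
  exists (y : nat -> R) (X : nat -> {set V}),
  [/\ forall k, y k.+1 <= y k,
      y #|V| = 0,
      \sum_(k < #|V|) y k ^+ 2 = \sum_u x u ^+ 2,
      forall u, x u = \sum_(k < #|V|) (y k - y k.+1) * (u \in X k)%:R &
      forall k, (k < #|V|)%N -> #|X k| = k.+1].
Proof.
move=> x0.
pose ge u v := x v <= x u.
pose s := sort ge (enum V).
have perm_s : perm_eq s (enum V) by rewrite perm_sort.
have size_s : size s = #|V| by rewrite (perm_size perm_s) cardE.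
have uniq_s : uniq s by rewrite (perm_uniq perm_s) enum_uniq.
have mem_s u : u \in s by rewrite (perm_mem perm_s) mem_enum.
have sorted_s : sorted ge s by apply: sort_sorted => u v; exact: le_total.
(* The default 0 makes [y] vanish from #|V| on; since x >= 0, [y] stays nonincreasing there. *)
pose y k := nth 0 (map x s) k.
have yn : y #|V| = 0 by rewrite /y nth_default// size_map size_s.
exists y, (fun k => [set u in take k.+1 s]); split => //.
- move=> k; rewrite /y; have [kn|kn] := ltnP k.+1 #|V|; last first.
    rewrite nth_default ?size_map ?size_s//.
    have [kn'|kn'] := ltnP k #|V|; last by rewrite nth_default ?size_map ?size_s.
    have /card_gt0P[v _] : (0 < #|V|)%N by exact: leq_ltn_trans kn'.
    by rewrite (nth_map v) ?size_s.
  have /card_gt0P[v _] : (0 < #|V|)%N by exact: leq_ltn_trans kn.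
  rewrite !(nth_map v) ?size_s// ?(ltnW kn)//.
  by move/sortedP : sorted_s; apply; rewrite size_s.
- rewrite -(big_mkord xpredT (fun k => y k ^+ 2)) -size_s -(size_map x s).
  rewrite -(big_nth 0 xpredT (fun r => r ^+ 2)) big_map (perm_big _ perm_s)/=.
  by rewrite big_enum.
- move=> u; set i := index u s.
  have iV : (i < #|V|)%N by rewrite -size_s index_mem.
  (* Only the layers from the position i of u onwards contain u, so the sum telescopes to y_i -
     y_#|V| = x u. *)
  have E (k : 'I_#|V|) : (u \in [set u in take k.+1 s]) = (i <= k)%N.
    by rewrite inE in_take.
  under eq_bigr do rewrite E.
  rewrite -(big_mkord xpredT (fun k => (y k - y k.+1) * (i <= k)%N%:R)).
  rewrite (big_cat_nat (n := i))//= ?(ltnW iV)//.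
  rewrite big_nat big1 => [|k /andP[_ ki]]; last by rewrite leqNgt ki mulr0.
  rewrite add0r big_nat.
  under eq_bigr => k /andP[ik _] do rewrite ik mulr1 -opprB.
  rewrite -big_nat sumrN telescope_sumr ?(ltnW iV)// yn sub0r opprK.
  by rewrite /y (nth_map u) ?size_s// nth_index.
- move=> k kn; rewrite cardsE (card_uniqP _) ?take_uniq//.
  by rewrite size_takel ?size_s.
Qed.

(** * The adjacency form and the two bounds *)

Section Quadratic.
Context {R : realType} {V : finType} (adj : rel V).

(** Working with functions on V keeps the enumeration of the vertices out of the graph arguments;
    [adjacency_formE] makes the link to matrices. *)
Definition adj_form (f g : V -> R) : R :=
  \sum_u \sum_v (adj u v)%:R * (f u * g v).

Lemma edges_betweenE (X Y : {set V}) :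
  (edges_between adj X Y)%:R =
  adj_form (fun u => (u \in X)%:R) (fun v => (v \in Y)%:R).
Proof.
rewrite /edges_between cardsE -sum1_card natr_sum big_mkcond/=.
rewrite /adj_form pair_big/=; apply: eq_bigr => -[u v] _ /=.
by rewrite unfold_in/=; case: (u \in X); case: (v \in Y); case: (adj u v);
  rewrite ?mulr1 ?mul1r ?mulr0 ?mul0r.
Qed.

Lemma cutM_ge0 : 0 <= cutM R adj.
Proof.
rewrite /cutM; elim/big_ind: _ => [||P _]; first by [].
  by move=> a b a0 b0; rewrite le_max a0.
by rewrite divr_ge0 ?sqrtr_ge0.
Qed.

Lemma edges_between_le_cutM (X Y : {set V}) :
  (0 < #|X|)%N -> (0 < #|Y|)%N ->
  (edges_between adj X Y)%:R <=
    cutM R adj * (Num.sqrt #|X|%:R * Num.sqrt #|Y|%:R).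
Proof.
move=> X0 Y0; rewrite -sqrtrM// -ler_pdivrMr; last first.
  by rewrite sqrtr_gt0 mulr_gt0 ?ltr0n.
pose F (P : {set V} * {set V}) : R :=
  (edges_between adj P.1 P.2)%:R / Num.sqrt (#|P.1|%:R * #|P.2|%:R).
by apply: (le_bigmax_cond _ F (j := (X, Y))) => //=; rewrite -!card_gt0 X0.
Qed.

Lemma adj_form_suml (n : nat) (c : 'I_n -> R) (F : 'I_n -> V -> R) (g : V -> R) :
  adj_form (fun u => \sum_k c k * F k u) g = \sum_k c k * adj_form (F k) g.
Proof.
rewrite /adj_form.
under [RHS]eq_bigr do rewrite mulr_sumr.
rewrite [RHS]exchange_big/=; apply: eq_bigr => u _.
under [RHS]eq_bigr do rewrite mulr_sumr.
rewrite [RHS]exchange_big/=; apply: eq_bigr => v _.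
by rewrite mulr_suml mulr_sumr; apply: eq_bigr => k _; ring.
Qed.

Lemma adj_form_sumr (n : nat) (c : 'I_n -> R) (F : 'I_n -> V -> R) (g : V -> R) :
  adj_form g (fun u => \sum_k c k * F k u) = \sum_k c k * adj_form g (F k).
Proof.
rewrite /adj_form.
under [RHS]eq_bigr do rewrite mulr_sumr.
rewrite [RHS]exchange_big/=; apply: eq_bigr => u _.
under [RHS]eq_bigr do rewrite mulr_sumr.
rewrite [RHS]exchange_big/=; apply: eq_bigr => v _.
by rewrite !mulr_sumr; apply: eq_bigr => k _; ring.
Qed.

(** The entries of the matrix are nonnegative, so this is the triangle inequality. It removes signs
    from an eigenvector, and later bounds the form from below. *)
Lemma adj_form_le_norm (f : V -> R) :
  `|adj_form f f| <= adj_form (fun u => `|f u|) (fun u => `|f u|).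
Proof.
apply: (le_trans (ler_norm_sum _ _ _)); apply: ler_sum => u _.
apply: (le_trans (ler_norm_sum _ _ _)); apply: ler_sum => v _.
by rewrite !normrM ger0_norm.
Qed.

Lemma adj_form_le_cutM (f : V -> R) : (0 < #|V|)%N -> (forall u, 0 <= f u) ->
  adj_form f f <= (4^-1 * ln (#|V|%:R : R) + 1) * cutM R adj * \sum_u f u ^+ 2.
Proof.
move=> V0 f0; have [y [X [ydec yn ysqr fE cardX]]] := level_sets _ _ _ f0.
pose d k := y k - y k.+1.
have d0 k : 0 <= d k by rewrite subr_ge0.
pose r k : R := Num.sqrt k%:R.
pose T := \sum_(k < #|V|) d k * r k.+1.
have layers : adj_form f f <= cutM R adj * T ^+ 2.
  rewrite (funext fE) adj_form_suml.
  (* The square is expanded over pairs of layers to be compared term by term; the weights d_k d_l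
     are nonnegative. *)
  have -> : cutM R adj * T ^+ 2 = \sum_(k < #|V|) d k *
      \sum_(l < #|V|) d l * (cutM R adj * (r k.+1 * r l.+1)).
    rewrite expr2 {1}/T mulr_suml mulr_sumr; apply: eq_bigr => k _.
    rewrite /T !mulr_sumr; apply: eq_bigr => l _; ring.
  apply: ler_sum => k _; apply: ler_wpM2l; first exact: d0.
  rewrite adj_form_sumr.
  apply: ler_sum => l _; apply: ler_wpM2l; first exact: d0.
  rewrite -edges_betweenE.
  have Xk := cardX _ (ltn_ord k); have Xl := cardX _ (ltn_ord l).
  rewrite /r -Xk -Xl; apply: edges_between_le_cutM; by rewrite ?Xk ?Xl.
apply: (le_trans layers); rewrite -mulrA [leRHS]mulrCA.
apply: ler_wpM2l; first exact: cutM_ge0.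
(* Both boundary terms vanish, as [r 0 = 0] and [y #|V| = 0]. *)
rewrite /T (sum_by_parts _ y r) ?yn ?mul0r ?subr0 -?ysqr; last exact: sqrtr0.
apply: (le_trans (sum_mul_sqr_le _ _ _ _)); rewrite mulrC; apply: ler_wpM2r.
  by apply: sumr_ge0 => k _; exact: sqr_ge0.
by move: V0; case: #|V| => // n _; apply: sum_sqr_sqrtB_le.
Qed.

Lemma adjacency_formE (x : 'rV[R]_#|V|) :
  (x *m adjacency R adj *m x^T) 0 0 =
  adj_form (fun u => x 0 (enum_rank u)) (fun u => x 0 (enum_rank u)).
Proof.
have rk := onW_bij predT (@enum_rank_bij V).
rewrite mxE (reindex _ rk)/= /adj_form [RHS]exchange_big/=; apply: eq_bigr => v _.
rewrite !mxE mulr_suml (reindex _ rk)/=; apply: eq_bigr => u _.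
by rewrite mxE !enum_rankK; ring.
Qed.

Lemma row_sqr_normE (x : 'rV[R]_#|V|) :
  (x *m x^T) 0 0 = \sum_u x 0 (enum_rank u) ^+ 2.
Proof.
rewrite mxE (reindex _ (onW_bij predT (@enum_rank_bij V)))/=.
by apply: eq_bigr => u _; rewrite mxE expr2.
Qed.

(** Replacing an eigenvector w by |w| keeps its norm and does not decrease the form, so the bound
    for nonnegative functions applies. *)
Lemma eigenvalue_le_cutM (a : R) : eigenvalue (adjacency R adj) a ->
  a <= (4^-1 * ln (#|V|%:R : R) + 1) * cutM R adj.
Proof.
move=> /eigenvalueP[w Aw w0].
have [i wi] : exists i, w 0 i != 0.
  by move/rV0Pn: w0.
have V0 : (0 < #|V|)%N by exact: leq_ltn_trans (ltn_ord i).
have s0 : 0 < (w *m w^T) 0 0.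
  rewrite row_sqr_normE (bigD1 (enum_val i))//= enum_valK ltr_wpDr//.
    by apply: sumr_ge0 => u _; exact: sqr_ge0.
  by rewrite lt_neqAle eq_sym sqrf_eq0 wi sqr_ge0.
rewrite -(ler_pM2r s0).
have -> : a * (w *m w^T) 0 0 = (w *m adjacency R adj *m w^T) 0 0.
  by rewrite Aw -scalemxAl [RHS]mxE.
rewrite adjacency_formE row_sqr_normE.
apply: (le_trans (ler_norm _)); apply: (le_trans (adj_form_le_norm _)).
apply: (le_trans (adj_form_le_cutM _ V0 (fun=> normr_ge0 _))).
by under eq_bigr do rewrite real_normK ?num_real//.
Qed.

Lemma edges_between_le_rayleigh (a : R) (X Y : {set V}) : symmetric adj ->
  (forall f : V -> R, adj_form f f <= a * \sum_u f u ^+ 2) ->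
  (0 < #|X|)%N -> (0 < #|Y|)%N ->
  (edges_between adj X Y)%:R / Num.sqrt (#|X|%:R * #|Y|%:R) <= a.
Proof.
move=> adj_sym ha X0 Y0.
set p : R := Num.sqrt #|X|%:R; set q : R := Num.sqrt #|Y|%:R.
have p0 : 0 < p by rewrite sqrtr_gt0 ltr0n.
have q0 : 0 < q by rewrite sqrtr_gt0 ltr0n.
pose f u : R := p^-1 * (u \in X)%:R; pose g u : R := q^-1 * (u \in Y)%:R.
have sumf (Z : {set V}) : (0 < #|Z|)%N ->
    \sum_u ((Num.sqrt (#|Z|%:R : R))^-1 * (u \in Z)%:R) ^+ 2 = 1.
  move=> Z0; under eq_bigr do rewrite exprMn.
  rewrite -mulr_sumr exprVn sqr_sqrtr//.
  have -> : \sum_u (u \in Z)%:R ^+ 2 = #|Z|%:R :> R.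
    rewrite -sum1_card natr_sum [RHS]big_mkcond/=; apply: eq_bigr => u _.
    by case: (u \in Z); rewrite ?expr1n ?expr0n.
  by rewrite mulVf// pnatr_eq0 -lt0n.
have E : (edges_between adj X Y)%:R / Num.sqrt (#|X|%:R * #|Y|%:R) = adj_form f g.
  rewrite edges_betweenE sqrtrM// -/p -/q /adj_form mulr_suml.
  apply: eq_bigr => u _; rewrite mulr_suml; apply: eq_bigr => v _.
  by rewrite /f /g; field; rewrite !gt_eqF.
have adj_formC : adj_form g f = adj_form f g.
  rewrite /adj_form exchange_big/=; apply: eq_bigr => u _; apply: eq_bigr => v _.
  by rewrite adj_sym (mulrC (g v)).
have polar : adj_form (fun u => f u + g u) (fun u => f u + g u) -
    adj_form (fun u => f u - g u) (fun u => f u - g u) =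
    2 * adj_form f g + 2 * adj_form g f.
  rewrite /adj_form -sumrB !mulr_sumr -big_split/=; apply: eq_bigr => u _.
  rewrite -sumrB !mulr_sumr -big_split/=; apply: eq_bigr => v _; ring.
have parallelogram :
    \sum_u (f u + g u) ^+ 2 + \sum_u (f u - g u) ^+ 2 = 4.
  have -> : 4 = 2 * \sum_u f u ^+ 2 + 2 * \sum_u g u ^+ 2.
    by rewrite /f /g !sumf//; ring.
  by rewrite !mulr_sumr -!big_split/=; apply: eq_bigr => u _; ring.
have Hp := ha (fun u => f u + g u).
(* Polarisation needs a lower bound on the form at f - g. Applying [ha] to |f - g| gives -a |f -
   g|^2, and the parallelogram law then yields 4 <f, A g> <= 4 a. *)
have Hm := ha (fun u => `|f u - g u|).
have := adj_form_le_norm (fun u => f u - g u); rewrite ler_norml => /andP[Hn _].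
have Hs : \sum_u `|f u - g u| ^+ 2 = \sum_u (f u - g u) ^+ 2.
  by apply: eq_bigr => u _; rewrite real_normK ?num_real.
rewrite Hs in Hm; rewrite E.
have : a * (\sum_u (f u + g u) ^+ 2 + \sum_u (f u - g u) ^+ 2) = 4 * a.
  by rewrite parallelogram mulrC.
rewrite mulrDr; lra.
Qed.

Lemma rayleigh_eigenvalue : symmetric adj -> (0 < #|V|)%N ->
  exists2 a, eigenvalue (adjacency R adj) a &
    forall f : V -> R, adj_form f f <= a * \sum_u f u ^+ 2.
Proof.
move=> adj_sym V0.
have As : (adjacency R adj)^T = adjacency R adj.
  by apply/matrixP => i j; rewrite !mxE adj_sym.
have [a ea Ha] := symmetric_rayleigh _ _ _ V0 As.
exists a => // f; have := Ha (\row_i f (enum_val i)).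
rewrite adjacency_formE row_sqr_normE.
have fE : (fun u => (\row_i f (enum_val i)) 0 (enum_rank u)) = f.
  by apply/funext => u; rewrite mxE enum_rankK.
by rewrite fE; under eq_bigr do rewrite mxE enum_rankK.
Qed.

Lemma cutM_le (a : R) : 0 <= a ->
  (forall X Y : {set V}, (0 < #|X|)%N -> (0 < #|Y|)%N ->
    (edges_between adj X Y)%:R / Num.sqrt (#|X|%:R * #|Y|%:R) <= a) ->
  cutM R adj <= a.
Proof.
move=> a0 H; apply: bigmax_le => //= -[X Y] /= /andP[X0 Y0].
by apply: H; rewrite card_gt0.
Qed.

End Quadratic.

(** * Both inequalities for the supremum of the eigenvalues *)

Theorem theorem1 (R : realType) (V : finType) (adj : rel V)
    (adj_sym : symmetric adj) (adj_irr : irreflexive adj) :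
  cutM R adj <= lambda_max R adj /\
  lambda_max R adj <= (4^-1 * ln (#|V|%:R : R) + 1) * cutM R adj.
Proof.
have ub a : eigenvalue (adjacency R adj) a -> a <= _ := eigenvalue_le_cutM adj a.
(* For empty V both quantities take their default value 0. *)
have [V0|V0] := posnP #|V|.
  have no_eig : [set a : R | eigenvalue (adjacency R adj) a]%classic = set0.
    apply/seteqP; split => // a /= /eigenvalueP[w _ /rV0Pn[i _]].
    by have := leq_ltn_trans (leq0n i) (ltn_ord i); rewrite V0.
  have -> : lambda_max R adj = 0 by rewrite /lambda_max no_eig sup0.
  have -> : cutM R adj = 0.
    apply/eqP; rewrite eq_le cutM_ge0 andbT; apply: cutM_le => // X Y.
    by move/leq_trans => /(_ _ (max_card _)); rewrite V0.
  by rewrite mulr0.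
have [a ea ray] := rayleigh_eigenvalue (R := R) adj adj_sym V0.
split; last by apply: ge_sup; [exists a | move=> b; exact: ub].
apply: (@le_trans _ _ a); last first.
  (* The supremum dominates its members only for a set bounded above; the upper estimate [ub]
     supplies this. *)
  by apply: ub_le_sup => //; eexists => b; exact: ub.
have edge_le := edges_between_le_rayleigh _ _ _ _ adj_sym ray.
apply: cutM_le => //.
(* What remains is 0 <= a, for the base value of the maximum; it follows from the edge bound at X =
   Y = V. *)
have := edge_le [set: V] [set: V]; rewrite cardsT => /(_ V0 V0).
by apply: le_trans; rewrite divr_ge0 ?sqrtr_ge0.
Qed.
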